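(* Let $\mu$ be a probability measure on $\mathbb{R}^n$ and let $H \colon \mathbb{R} \to [0,\infty)$ be an even convex function, non-decreasing on $[0,\infty)$, with $H(0)=0$, such that moreover $x \mapsto H(\sqrt{x})$ is convex on $[0,\infty)$. Assume that, for some constant $c\in(0,\infty)$, $\mu$ satisfies the modified log-Sobolev inequality $$ \mathrm{Ent}_\mu(e^f) \leq c \int \sum_{i=1}^n H \left( \frac{\partial_i f}{2} \right)e^f d\mu \qquad\text{for all locally Lipschitz } f\colon\mathbb{R}^n\to\mathbb{R}. $$ Then, for all locally Lipschitz functions $f \colon \mathbb{R}^n \to \mathbb{R}$ with $\int f\, d\mu =0$ and all $\alpha>c$, $$ \int e^f d\mu \leq \left( \int \exp \left\{ \alpha \sum_{i=1}^n H \left(\frac{\partial_i f}{2} \right) \right\} d\mu \right)^\frac{c}{\alpha-c}. $$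
   Context: $\partial_i f=\partial f/\partial x_i$. For a non-negative function $g$, $\mathrm{Ent}_\mu(g)=\int g\log g\,d\mu-\int g\,d\mu\,\log\int g\,d\mu$. *)

(* Defs.v *)
From HB Require Import structures.
From mathcomp Require Import all_boot all_order all_algebra.
From mathcomp Require Import all_classical all_reals all_analysis.
Set Implicit Arguments.
Unset Strict Implicit.
Unset Printing Implicit Defensive.
Import Order.TTheory GRing.Theory Num.Theory.
Import numFieldNormedType.Exports.
Local Open Scope classical_set_scope.
Local Open Scope ring_scope.

(* R^n with its Borel sigma-algebra; convertible to 'rV[R]_n. *)
Notation borel_rV R n := (g_sigma_algebraType (@open 'rV[R]_n)).

(* Stated pointwise because the library's [locally [lipschitz f x | x in A]]
   localises around pairs of points of A.  The norm on 'rV[R]_n is the sup norm,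
   which is equivalent to the Euclidean one. *)
Definition locally_lipschitz (R : realType) (n : nat) (f : 'rV[R]_n -> R) :=
  forall x : 'rV[R]_n, exists2 U, nbhs x U & [lipschitz f y | y in U].

(* Where the partial derivative does not exist, 'D takes the default value 0
   of the limit operator.  By Rademacher's theorem this occurs, for locally
   Lipschitz f, only on a Lebesgue-null set. *)
Definition partial (R : realType) (n : nat) (i : 'I_n) (f : 'rV[R]_n -> R)
    (x : 'rV[R]_n) : R :=
  'D_(delta_mx 0 i) f x.

(* Meaningful for g >= 0 with finite integral; ln 0 = 0, so 0 log 0 = 0.  When
   the integrals of g and of g log g are both +oo, the value is
   +oo - +oo = -oo, so that an upper bound on Ent mu g is then void. *)
Definition Ent (d : measure_display) (T : measurableType d) (R : realType)
    (mu : probability T R) (g : T -> R) : \bar R :=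
  (\int[mu]_x (g x * ln (g x))%:E
   - \int[mu]_x (g x)%:E * lne (\int[mu]_x (g x)%:E))%E.

(* Main.v *)
(* With [L t := \int expR (t f)], the function [ln (L t) / t] tends to [\int f]
   at [0+], and its derivative is [Ent (expR (t f)) / (t^2 L t)].  Convexity of
   [H \o sqrt] gives [H (t x) <= t^2 H x], so the log-Sobolev inequality and the
   Gibbs variational formula applied to [W := alpha * sum_i H (d_i f / 2)] yield
     [Ent (expR (t f))
        <= c t^2 / alpha * (Ent (expR (t f)) + L t * ln (\int expR W))],
   i.e. the derivative is at most [c / (alpha - c) * ln (\int expR W)] on [0, 1].
   This is done for the truncations of [f] to [-N, N], whose partial derivatives
   are those of [f] or 0, and [N] then goes to infinity. *)
Require Import Defs.
From HB Require Import structures.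
From mathcomp Require Import all_boot all_order all_algebra.
From mathcomp Require Import all_classical all_reals all_analysis.
From mathcomp Require Import measurable_realfun ring lra.
Set Implicit Arguments.
Unset Strict Implicit.
Unset Printing Implicit Defensive.
Import Order.TTheory GRing.Theory Num.Theory.
Import numFieldNormedType.Exports.
Local Open Scope classical_set_scope.
Local Open Scope ring_scope.

(** * Integrals of possibly non-measurable functions, and the Gibbs variational inequality *)

Section lower_integral.
Context d (T : measurableType d) (R : realType).
Import HBNNSimple.

(** The integral of a non-negative function is by definition a supremum over the simple functions
    below it, so no measurability of [F] is involved. This is how integrals containing partial
    derivatives are bounded. *)
Lemma ge0_integral_le_nnsfun (mu : {measure set T -> \bar R}) (F : T -> \bar R)
    (C : \bar R) : (forall x, 0 <= F x)%E ->
  (forall s : {nnsfun T >-> R}, (forall x, (s x)%:E <= F x)%E ->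
     (\int[mu]_x (s x)%:E <= C)%E) ->
  (\int[mu]_x F x <= C)%E.
Proof.
move=> F0 FC; rewrite ge0_integralE// patch_setT.
apply: ge_ereal_sup => _ [s /= sF <-].
by rewrite -integralT_nnsfun; exact: FC.
Qed.

(** A simple function below [F] is also below [G], so the suprema defining the two integrals compare
    without measurability. *)
Lemma ge0_le_lower_integral (mu : {measure set T -> \bar R})
    (F G : T -> \bar R) :
  (forall x, 0 <= F x)%E -> (forall x, F x <= G x)%E ->
  (\int[mu]_x F x <= \int[mu]_x G x)%E.
Proof.
move=> F0 FG; have G0 x : (0 <= G x)%E by rewrite (le_trans _ (FG x)).
rewrite ge0_integralE// ge0_integralE// !patch_setT.
apply: ereal_sup_le => _ [s /= sF <-]; exists s => // x.
exact: le_trans (sF x) (FG x).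
Qed.

Lemma integrable_bounded (mu : probability T R) (f : T -> R) (M : R) :
  measurable_fun setT f -> (forall x, `|f x| <= M) ->
  mu.-integrable setT (EFin \o f).
Proof.
move=> mf fM; apply: measurable_bounded_integrable => //.
  by rewrite [ltLHS]probability_setT ltry.
exists M; split; first exact: num_real.
by move=> z Mz x _; exact: le_trans (fM x) (ltW Mz).
Qed.

Lemma Rintegral_cst_probability (mu : probability T R) (r : R) :
  \int[mu]_x r = r.
Proof.
have mu1 : (mu : {measure set T -> \bar R}) setT = 1%E.
  exact: probability_setT.
by rewrite Rintegral_cst// mu1 mulr1.
Qed.

Lemma Rintegral_gt0_bound (mu : probability T R) (f : T -> R) (m : R) :
  0 < m -> mu.-integrable setT (EFin \o f) -> (forall x, m <= f x) ->
  0 < \int[mu]_x f x.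
Proof.
move=> m0 intf mf; rewrite (lt_le_trans m0)//.
rewrite -[leLHS](Rintegral_cst_probability mu) le_Rintegral//.
exact: finite_measure_integrable_cst.
Qed.

Lemma Rintegral_EFin (mu : probability T R) (f : T -> R) :
  mu.-integrable setT (EFin \o f) ->
  (\int[mu]_x (f x)%:E)%E = (\int[mu]_x f x)%:E.
Proof.
by move=> intf; rewrite /Rintegral fineK//; exact: integrable_fin_num.
Qed.

Lemma ge0_Rintegral_EFin (mu : probability T R) (f : T -> R) :
  (forall x, 0 <= f x) -> (\int[mu]_x (f x)%:E < +oo)%E ->
  (\int[mu]_x (f x)%:E)%E = (\int[mu]_x f x)%:E.
Proof.
move=> f0 foo; rewrite /Rintegral fineK// ge0_fin_numE// integral_ge0// => x _.
by rewrite lee_fin.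
Qed.

Lemma Rintegral_expR_ge1 (mu : probability T R) (W : T -> R) :
  (forall x, 0 <= W x) -> (\int[mu]_x (expR (W x))%:E < +oo)%E ->
  1 <= \int[mu]_x expR (W x).
Proof.
move=> W0 Woo; rewrite -lee_fin -ge0_Rintegral_EFin//.
have <- : (\int[mu]_x (cst 1%:E x))%E = 1%:E :> \bar R.
  by rewrite integral_cst// mul1e; exact: probability_setT.
apply: ge0_le_lower_integral => x; rewrite !lee_fin//.
by rewrite -expR0 ler_expR.
Qed.

Lemma integrable_expR_bounded (mu : probability T R) (u : T -> R) (M : R) :
  measurable_fun setT u -> (forall x, `|u x| <= M) ->
  mu.-integrable setT (EFin \o (fun x => expR (u x))).
Proof.
move=> mu_ uM; apply: (@integrable_bounded _ _ (expR M)).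
  exact: measurableT_comp.
by move=> x; rewrite ger0_norm ?expR_ge0// ler_expR (le_trans (ler_norm _)).
Qed.

Lemma integrable_mul_expR (mu : probability T R) (f u : T -> R) (K M : R) :
  measurable_fun setT f -> (forall x, `|f x| <= K) ->
  measurable_fun setT u -> (forall x, `|u x| <= M) ->
  mu.-integrable setT (EFin \o (fun x => f x * expR (u x))).
Proof.
move=> mf fK mu_ uM; apply: (@integrable_bounded _ _ (K * expR M)).
  by apply: measurable_funM => //; exact: measurableT_comp.
move=> x; rewrite normrM ler_pM// [`|expR _|]ger0_norm ?expR_ge0// ler_expR.
by rewrite (le_trans (ler_norm _)).
Qed.

Lemma Rintegral_expR_gt0 (mu : probability T R) (u : T -> R) (M : R) :
  measurable_fun setT u -> (forall x, `|u x| <= M) ->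
  0 < \int[mu]_x expR (u x).
Proof.
move=> mu_ uM; apply: (@Rintegral_gt0_bound _ _ (expR (- M))).
- exact: expR_gt0.
- exact: integrable_expR_bounded uM.
- by move=> x; rewrite ler_expR; move: (uM x); rewrite ler_norml => /andP[].
Qed.

Lemma Ent_expR (mu : probability T R) (u : T -> R) (M : R)
    (A := \int[mu]_x expR (u x)) :
  measurable_fun setT u -> (forall x, `|u x| <= M) ->
  Ent mu (fun x => expR (u x)) =
    (\int[mu]_x (u x * expR (u x)) - A * ln A)%:E.
Proof.
move=> mu_ uM; have A0 : 0 < A by exact: Rintegral_expR_gt0 uM.
rewrite /Ent; under [X in (X - _)%E]eq_integral do rewrite expRK mulrC.
rewrite Rintegral_EFin; last exact: integrable_expR_bounded uM.
rewrite Rintegral_EFin; last exact: (integrable_mul_expR mu mu_ uM mu_ uM).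
by rewrite /lne lt_geF// -EFinM -EFinB.
Qed.

(** Apply [1 + z <= expR z] at [z = w x - u x + ln A - ln B], with [B] the integral of [expR w], and
    multiply by [expR (u x)]: this is [w x * expR (u x) <= q x] for the [q] of the proof. In the
    integral of [q], the term [A / B * expR w] contributes [A], which cancels the [- A] of the
    middle term. *)
Lemma Rintegral_gibbs (mu : probability T R) (u w : T -> R) (M N : R)
    (A := \int[mu]_x expR (u x)) :
  measurable_fun setT u -> (forall x, `|u x| <= M) ->
  measurable_fun setT w -> (forall x, `|w x| <= N) ->
  \int[mu]_x (w x * expR (u x)) <=
    \int[mu]_x (u x * expR (u x)) - A * ln A +
    A * ln (\int[mu]_x expR (w x)).
Proof.
move=> mu_ uM mw wN; set B := \int[mu]_x expR (w x).
have A0 : 0 < A by exact: Rintegral_expR_gt0 uM.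
have B0 : 0 < B by exact: Rintegral_expR_gt0 wN.
have iu : mu.-integrable setT (EFin \o (fun x => expR (u x))).
  exact: integrable_expR_bounded uM.
have iw : mu.-integrable setT (EFin \o (fun x => expR (w x))).
  exact: integrable_expR_bounded wN.
pose q x := u x * expR (u x) + ((ln B - ln A - 1) * expR (u x)) +
  A / B * expR (w x).
have iZ k f : mu.-integrable setT (EFin \o f) ->
    mu.-integrable setT (EFin \o (fun x => k * f x)).
  move=> intf; rewrite (_ : EFin \o _ = fun x => (k%:E * (EFin \o f) x)%E).
    exact: integrableZl.
  by apply/funext => x /=; rewrite EFinM.
have iD f g : mu.-integrable setT (EFin \o f) ->
    mu.-integrable setT (EFin \o g) ->
    mu.-integrable setT (EFin \o (fun x => f x + g x)).
  by move=> intf intg; exact: (integrableD _ intf intg).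
have i1 : mu.-integrable setT (EFin \o (fun x => u x * expR (u x))).
  exact: (integrable_mul_expR mu mu_ uM mu_ uM).
have i2 := iZ (ln B - ln A - 1) _ iu.
have i3 := iZ (A / B) _ iw.
apply: (@le_trans _ _ (\int[mu]_x q x)).
  apply: le_Rintegral => //.
  - exact: (integrable_mul_expR mu mw wN mu_ uM).
  - exact/iD/i3/iD.
  - move=> x _; rewrite /q.
    have -> : A / B * expR (w x) =
        expR (w x - u x + ln A - ln B) * expR (u x).
      rewrite -expRD -{1}(lnK A0) -{1}(lnK B0) -expRN -!expRD.
      by congr expR; ring.
    rewrite -!mulrDl ler_wpM2r ?expR_ge0//.
    by have := expR_ge1Dx (w x - u x + ln A - ln B); lra.
rewrite /q RintegralD//; last exact: iD.
rewrite RintegralD// !RintegralZl// -/A -/B divfK ?gt_eqF//.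
lra.
Qed.

(* [W] need not be measurable (nor are partial derivatives known to be): the
   bound is proved for the simple functions below [k * W * expR u]. *)
Lemma lower_integral_gibbs (mu : probability T R) (u W : T -> R) (M k : R)
    (A := \int[mu]_x expR (u x)) :
  measurable_fun setT u -> (forall x, `|u x| <= M) -> (forall x, 0 <= W x) ->
  0 < k -> (\int[mu]_x (expR (W x))%:E < +oo)%E ->
  (\int[mu]_x (k * W x * expR (u x))%:E <=
    (k * (\int[mu]_x (u x * expR (u x)) - A * ln A +
    A * ln (\int[mu]_x expR (W x))))%:E)%E.
Proof.
move=> mu_ uM W0 k0 Woo.
apply: ge0_integral_le_nnsfun => [x|s sW].
  by rewrite lee_fin mulr_ge0 ?expR_ge0// mulr_ge0 ?W0// ltW.
(* [w] solves [s = k * w * expR u]. It is measurable and bounded because [s] and [u] are, and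
   [s <= k * W * expR u] means [w <= W]; the bounded Gibbs inequality thus applies to [w]. *)
pose w x := k^-1 * s x * expR (- u x).
have [K [_ sK]] := simple_bounded s.
have {}sK x : `|s x| <= `|K| + 1.
  by apply: sK => //; rewrite (le_lt_trans (ler_norm K))// ltrDl.
have mw : measurable_fun setT w.
  apply: measurable_funM; first exact: measurable_funM.
  by apply: measurableT_comp => //; exact: measurableT_comp.
have wN x : `|w x| <= `|k^-1| * (`|K| + 1) * expR M.
  rewrite /w 2!normrM ler_pM//; first by rewrite ler_wpM2l.
  rewrite ger0_norm ?expR_ge0// ler_expR.
  by rewrite (le_trans (ler_norm _))// normrN.
have wW x : w x <= W x.
  rewrite /w expRN ler_pdivrMr ?expR_gt0// ler_pdivrMl// mulrA.
  by have := sW x; rewrite lee_fin.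
have wE x : s x = k * (w x * expR (u x)).
  rewrite /w -!mulrA -expRD addNr expR0 mulr1 mulrA divff ?mul1r//.
  by rewrite gt_eqF.
have intwu : mu.-integrable setT (EFin \o (fun x => w x * expR (u x))).
  exact: (integrable_mul_expR mu mw wN mu_ uM).
rewrite (@Rintegral_EFin mu s); last by apply: integrable_bounded sK.
rewrite lee_fin.
under eq_Rintegral do rewrite wE.
rewrite RintegralZl// ler_pM2l//.
apply: (le_trans (Rintegral_gibbs mu mu_ uM mw wN)).
rewrite lerD2l ler_pM2l; last exact: Rintegral_expR_gt0 uM.
have B0 : 0 < \int[mu]_x expR (w x) by exact: Rintegral_expR_gt0 wN.
have BW : \int[mu]_x expR (w x) <= \int[mu]_x expR (W x).
  rewrite -lee_fin -Rintegral_EFin; last exact: integrable_expR_bounded wN.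
  rewrite -ge0_Rintegral_EFin//.
  by apply: ge0_le_lower_integral => x; rewrite lee_fin ?expR_ge0// ler_expR.
by rewrite ler_ln// posrE// (lt_le_trans B0).
Qed.

End lower_integral.

(** * The Herbst argument for bounded functions *)

Section herbst.
Context d (T : measurableType d) (R : realType) (mu : probability T R).

Lemma is_derive_laplace (u : T -> R) (M t : R) :
  measurable_fun setT u -> (forall x, `|u x| <= M) ->
  is_derive t 1 (fun t => \int[mu]_x expR (t * u x))
    (\int[mu]_x (u x * expR (t * u x))).
Proof.
move=> mu_ uM.
have mtu s : measurable_fun setT (fun x => s * u x) by exact: measurable_funM.
have tuM s x : `|s * u x| <= `|s| * M by rewrite normrM ler_wpM2l.
have dE (s : R) (y : T) :
    is_derive s 1 (fun s => expR (s * u y)) (u y * expR (s * u y)).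
  by apply: is_derive_eq; rewrite /GRing.scale /=; ring.
have It : `](t - 1), (t + 1)[%classic t.
  by rewrite /= in_itv/= ltrBlDr !ltrDl ltr01.
have dv := @differentiation_under_integral R d T mu
  (fun s x => expR (s * u x)) setT measurableT t (t - 1) (t + 1) It.
have dd := @derivable_under_integral R d T mu
  (fun s x => expR (s * u x)) setT measurableT t (t - 1) (t + 1) It.
have intf x : `](t - 1), (t + 1)[%classic x ->
    mu.-integrable setT (EFin \o (fun y => expR (x * u y))).
  by move=> _; exact: integrable_expR_bounded (tuM x).
have derf (x : R) (y : T) : `](t - 1), (t + 1)[%classic x -> setT y ->
  derivable (fun s : R => expR (s * u y)) x 1 by move=> _ _; exact: ex_derive.
(* A constant dominating [u y * expr] with [expr = expR (s * u y)], for all [s] within distance 1 of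
   [t]. *)
pose G (_ : T) := M * expR ((`|t| + 1) * M).
have M0 (y : T) : 0 <= M by rewrite (le_trans _ (uM y)).
have G0 y : 0 <= G y by rewrite mulr_ge0 ?expR_ge0 ?(M0 y).
have intG : mu.-integrable setT (EFin \o G).
  exact: finite_measure_integrable_cst.
have GE (x : R) (y : T) : partial1of2 (fun s x => expR (s * u x)) x y =
    u y * expR (x * u y).
  by rewrite partial1of2E derive_val.
have Gub (x : R) (y : T) : `](t - 1), (t + 1)[%classic x -> setT y ->
    `|partial1of2 (fun s x => expR (s * u x)) x y| <= G y.
  rewrite /= in_itv/= => /andP[tx xt] _; rewrite GE normrM ler_pM//.
  rewrite ger0_norm ?expR_ge0// ler_expR (le_trans (ler_norm _))// normrM.
  rewrite ler_pM// -[x](subrK t) addrC (le_trans (ler_normD _ _))// lerD2l.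
  by rewrite ltW// ltr_distl tx xt.
apply: DeriveDef; first exact: (dd intf derf G).
rewrite -derive1E (dv intf derf G)//.
by apply: eq_Rintegral => y _; rewrite GE.
Qed.

(** With [L t] the integral of [expR (t * u)], the entropy bound makes [ln (L t) / t - K * t]
    non-increasing on []0, 1]]. Its value at 1 is then compared with its behaviour at [0+], where
    [ln (L t) / t] tends to the mean of [u]. The factor [t ^+ 2 / alpha * W] is what the log-Sobolev
    inequality for [t * u] yields once [H] has been scaled. *)
Lemma herbst_bounded (u W : T -> R) (M c alpha : R) :
  measurable_fun setT u -> (forall x, `|u x| <= M) -> (forall x, 0 <= W x) ->
  0 < c -> c < alpha -> (\int[mu]_x (expR (W x))%:E < +oo)%E ->
  (forall t, 0 < t <= 1 -> (Ent mu (fun x => expR (t * u x)) <=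
    c%:E * \int[mu]_x (t ^+ 2 / alpha * W x * expR (t * u x))%:E)%E) ->
  ln (\int[mu]_x expR (u x)) <=
    \int[mu]_x u x + c / (alpha - c) * ln (\int[mu]_x expR (W x)).
Proof.
move=> mu_ uM W0 c0 ca Woo entW.
have a0 : 0 < alpha by rewrite (lt_trans c0).
have ac0 : 0 < alpha - c by rewrite subr_gt0.
set l := ln (\int[mu]_x expR (W x)); set K := c / (alpha - c) * l.
have l0 : 0 <= l by rewrite ln_ge0// Rintegral_expR_ge1.
pose L t := \int[mu]_x expR (t * u x).
pose L' t := \int[mu]_x (u x * expR (t * u x)).
have mtu s : measurable_fun setT (fun x => s * u x) by exact: measurable_funM.
have tuM s x : `|s * u x| <= `|s| * M by rewrite normrM ler_wpM2l.
have L_gt0 t : 0 < L t by exact: Rintegral_expR_gt0 (tuM t).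
have dL (t : R) : is_derive t 1 L (L' t) by exact: is_derive_laplace uM.
have L0 : L 0 = 1.
  rewrite /L; under eq_Rintegral do rewrite mul0r expR0.
  exact: Rintegral_cst_probability.
have L'0 : L' 0 = \int[mu]_x u x.
  by apply: eq_Rintegral => x _; rewrite mul0r expR0 mulr1.
have ent t : 0 < t <= 1 -> t * L' t - L t * ln (L t) <= t ^+ 2 * L t * K.
  move=> /[dup] t01 /andP[t0 t1].
  have k0 : 0 < t ^+ 2 / alpha by rewrite divr_gt0// exprn_gt0.
  have := entW t t01; rewrite (Ent_expR _ (mtu t) (tuM t)).
  have := lower_integral_gibbs (mtu t) (tuM t) W0 k0 Woo.
  rewrite -/(L t) -/l.
  have -> : \int[mu]_x (t * u x * expR (t * u x)) = t * L' t.
    under eq_Rintegral do rewrite -mulrA.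
    by rewrite RintegralZl//; exact: (integrable_mul_expR mu mu_ uM _ (tuM t)).
  set E := t * L' t - L t * ln (L t) => lW /le_trans.
  have {}lW : (c%:E * \int[mu]_x (t ^+ 2 / alpha * W x * expR (t * u x))%:E <=
      (c * (t ^+ 2 / alpha * (E + L t * l)))%:E)%E.
    by rewrite [leRHS]EFinM lee_pmul2l.
  move=> /(_ _ lW); rewrite lee_fin => {lW}.
  have -> : c * (t ^+ 2 / alpha * (E + L t * l)) =
      c * t ^+ 2 * (E + L t * l) / alpha by ring.
  rewrite ler_pdivlMr// => EaE.
  have Ll0 : 0 <= L t * l by rewrite mulr_ge0// ltW.
  have t21 : c * t ^+ 2 <= c by rewrite ger_pMr// exprn_ile1// ltW.
  have -> : t ^+ 2 * L t * K = c * t ^+ 2 * (L t * l) / (alpha - c).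
    by rewrite /K; ring.
  rewrite ler_pdivlMr//.
  (* The term [c * t ^+ 2 * E] on the right of [EaE] is absorbed by the left-hand side through
     [c * t ^+ 2 <= c], which requires [0 <= E]. For [E <= 0] the goal compares a non-positive
     number with a non-negative one. *)
  have [E0|/ltW E0] := leP E 0.
    apply: (@le_trans _ _ 0); first by rewrite mulr_le0_ge0// ltW.
    by rewrite mulr_ge0// mulr_ge0 ?ltW// exprn_gt0.
  have : E * (c * t ^+ 2) <= E * c by rewrite ler_wpM2l.
  by move: EaE; rewrite !mulrDr !mulrDl => *; lra.
(* The numerator in the derivative of [ln (L t) / t] is the entropy bounded in [ent]; subtracting
   [K * t] makes the derivative non-positive on []0, 1]]. *)
pose psi (t : R) := ln (L t) * t^-1 - K * t.
have dpsi (t : R) : 0 < t -> is_derive t 1 psi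
    ((t * L' t - L t * ln (L t)) / (t ^+ 2 * L t) - K).
  move=> t0; have tn0 : t != 0 by rewrite gt_eqF.
  have Ln0 : L t != 0 by rewrite gt_eqF.
  have dln : is_derive t 1 (@ln R \o L) ((L t)^-1 * L' t).
    by apply: is_derive1_comp; exact: is_derive1_ln.
  have dV : is_derive t 1 (fun t : R => t^-1) (- t ^- 2).
    have := @is_derive_id _ _ t (1 : R) => -[di Di].
    apply: DeriveDef; first exact: derivableV.
    by rewrite deriveV// Di /GRing.scale/= mulr1.
  have dK : is_derive t 1 (fun t : R => K * t) K.
    by apply: is_derive_eq; rewrite /GRing.scale /=; ring.
  apply: (is_derive_eq (is_deriveB (is_deriveM dln dV) dK)).
  rewrite /GRing.scale /=.
  by field; rewrite Ln0.
have psi_le (s : R) : 0 < s -> s <= 1 -> psi 1 <= psi s.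
  move=> s0 s1; apply: (@ler0_derive1_nincr _ psi s 1) => //.
  - move=> x; rewrite in_itv/= => /andP[sx _].
    by have [] := dpsi x (lt_trans s0 sx).
  - move=> x; rewrite in_itv/= => /andP[sx x1].
    have x0 := lt_trans s0 sx; have [_] := dpsi x x0.
    rewrite derive1E => ->.
    rewrite subr_le0 ler_pdivrMr ?mulr_gt0 ?exprn_gt0//.
    by rewrite [K * _]mulrC ent// x0 ltW.
  - apply: derivable_within_continuous => x; rewrite in_itv/= => /andP[sx _].
    by have [] := dpsi x (lt_le_trans s0 sx).
have L1 : L 1 = \int[mu]_x expR (u x).
  by apply: eq_Rintegral => x _; rewrite mul1r.
rewrite -L1 -lerBlDr.
have -> : ln (L 1) - K = psi 1 by rewrite /psi invr1 !mulr1.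
rewrite -L'0.
(* The quotients [(L h - 1) / h] tend to [L' 0], so it suffices that they are at least [psi 1] for
   small [h > 0]. This follows from [psi 1 <= psi h <= ln (L h) / h <= (L h - 1) / h], where the
   second inequality uses [0 <= K] and the third [ln (1 + x) <= x]. *)
have [/cvg_ex[/= z dz] zE] := dL 0.
have {zE} zE : z = L' 0 by rewrite -zE /derive; apply/esym/cvg_lim.
move: dz; rewrite zE => /cvg_dnbhs_at_right dz.
apply: (cvgr_to_ge dz).
near=> h.
have h0 : 0 < h by [].
have h1 : h <= 1 by near: h; exact: nbhs_right_le.
rewrite [h%:A]mulr1 addr0 L0 /GRing.scale /= mulrC.
apply: (le_trans (psi_le h h0 h1)).
have lnL : ln (L h) <= L h - 1.
  have := @le_ln1Dx _ (L h - 1); rewrite addrCA subrr addr0; apply.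
  by rewrite ltrBDr addNr.
have Kh : 0 <= K * h by rewrite mulr_ge0 ?(ltW h0)// mulr_ge0// divr_ge0 ?ltW.
by rewrite /psi lerBlDr ler_wpDr// ler_pM2r ?invr_gt0.
Unshelve. all: by end_near. Qed.

End herbst.

(** * Directional derivatives at extrema and under scaling *)

Section extremum.
Context (R : realType) (V : normedModType R).

(* The default value 0 of the limit makes the following lemmas hold without any
   derivability assumption. *)
Lemma derive_not_derivable (f : V -> R) (x v : V) :
  ~ derivable f x v -> 'D_v f x = 0.
Proof. by move=> ndf; rewrite /derive dvgP. Qed.

Lemma derive_at_max (f : V -> R) (x v : V) :
  (forall y, f y <= f x) -> 'D_v f x = 0.
Proof.
move=> fx; have [df|ndf] := pselect (derivable f x v); last first.
  exact: derive_not_derivable.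
have df' : h^-1 *: ((f \o shift x) (h *: v) - f x) @[h --> 0^'] --> 'D_v f x.
  exact: df.
apply/eqP; rewrite eq_le; apply/andP; split.
(* At a maximum the difference quotients are non-positive from the right and non-negative from the
   left. *)
- apply: (cvgr_to_le (cvg_dnbhs_at_right df')).
  near=> h; rewrite /GRing.scale /= pmulr_rle0 ?subr_le0//.
  by rewrite invr_gt0.
- apply: (cvgr_to_ge (cvg_dnbhs_at_left df')).
  near=> h; rewrite /GRing.scale /= nmulr_rge0 ?subr_le0//.
  by rewrite invr_lt0.
Unshelve. all: by end_near. Qed.

Lemma derive_at_min (f : V -> R) (x v : V) :
  (forall y, f x <= f y) -> 'D_v f x = 0.
Proof.
move=> fx; have [df|ndf] := pselect (derivable f x v); last first.
  exact: derive_not_derivable.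
apply/eqP; rewrite -oppr_eq0 -deriveN//; apply/eqP.
by apply: derive_at_max => y; rewrite lerN2.
Qed.

Lemma derive_mull (f : V -> R) (x v : V) (t : R) :
  'D_v (fun y => t * f y) x = t * 'D_v f x.
Proof.
have [->|t0] := eqVneq t 0.
  rewrite mul0r (_ : (fun _ => _) = cst 0) ?derive_cst//.
  by apply/funext => y; rewrite mul0r.
have [df|ndf] := pselect (derivable f x v); first exact: (deriveZ t df).
rewrite (derive_not_derivable ndf) mulr0.
(* For [t != 0], multiplying by [t^-1] carries derivability back from [t * f] to [f], so both sides
   take the default value together. *)
apply: derive_not_derivable => dtf; apply: ndf.
have -> : f = fun y => t^-1 *: (t * f y).
  by apply/funext => y; rewrite /GRing.scale /= mulKf.
by apply: derivableZ.
Qed.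

End extremum.

(** * Truncation to [[- N, N]] and its derivatives *)

Definition clamp (R : realType) (N r : R) : R := Num.max (- N) (Num.min r N).

Section clamp.
Context (R : realType) (N : R).

Lemma clamp_lipschitz a b : `|clamp N a - clamp N b| <= `|a - b|.
Proof.
rewrite /clamp /Num.max /Num.min; rewrite ler_norml.
have := ler_norm (a - b); have := ler_norm (- (a - b)); rewrite normrN.
do ![case: ifPn; rewrite -?leNgt ?ltNge => //]; move=> *.
all: by apply/andP; split; lra.
Qed.

Lemma clamp_bound r : 0 <= N -> `|clamp N r| <= N.
Proof.
move=> N0; rewrite /clamp ler_norml le_max lexx/= ge_max ge_min lexx orbT andbT.
lra.
Qed.

Lemma clamp_id r : `|r| <= N -> clamp N r = r.
Proof. by rewrite ler_norml /clamp => /andP[? ?]; rewrite min_l// max_r. Qed.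

Lemma norm_clamp_le r : 0 <= N -> `|clamp N r| <= `|r|.
Proof.
move=> N0; have := clamp_lipschitz r 0.
by rewrite (@clamp_id 0) ?normr0// !subr0.
Qed.

(** Where [N <= f x] the truncation has a global maximum at [x], and where [f x <= - N] a global
    minimum, so its derivative is 0. Elsewhere, by continuity, it coincides with [f] near [x]. No
    chain rule and no derivability of [f] enter. *)
Lemma derive_clamp (V : normedModType R) (f : V -> R) (x v : V) (t : R) :
  0 < t -> 0 <= N -> {for x, continuous f} ->
  'D_v (fun y => t * clamp N (f y)) x = t * 'D_v f x \/
  'D_v (fun y => t * clamp N (f y)) x = 0.
Proof.
move=> t0 N0 cf.
have cN y : - N <= clamp N y <= N by rewrite -ler_norml clamp_bound.
have [Nf|fN] := leP N (f x).
  right; apply: derive_at_max => y; rewrite ler_pM2l//.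
  have -> : clamp N (f x) = N by rewrite /clamp min_r// max_r// ge0_cp.
  by have /andP[] := cN (f y).
have [Nf|Nf] := leP (f x) (- N).
  right; apply: derive_at_min => y; rewrite ler_pM2l//.
  have -> : clamp N (f x) = - N by rewrite /clamp min_l ?(ltW fN)// max_l.
  by have /andP[] := cN (f y).
left; rewrite -derive_mull; apply: near_eq_derive.
near=> y; rewrite clamp_id// ler_norml; apply/andP; split; apply: ltW; near: y.
  exact: (cvgr_gt (f x)).
exact: (cvgr_lt (f x)).
Unshelve. all: by end_near. Qed.

End clamp.

(** * Continuity and Borel measurability of locally Lipschitz functions *)

Section locally_lipschitz.
Context (R : realType) (n : nat).

Lemma locally_lipschitz_comp (g : R -> R) (f : 'rV[R]_n -> R) :
  (forall a b, `|g a - g b| <= `|a - b|) -> locally_lipschitz f ->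
  locally_lipschitz (g \o f).
Proof.
move=> gl fl x; have [U Ux fU] := fl x; exists U => //.
move: fU; rewrite /lipschitz_on; apply: filterS => M fM y Uy.
exact: le_trans (gl _ _) (fM y Uy).
Qed.

Lemma locally_lipschitz_continuous (f : 'rV[R]_n -> R) :
  locally_lipschitz f -> continuous f.
Proof.
move=> fl x; have [U Ux [M [_ fU]]] := fl x.
(* The Lipschitz condition holds for all constants greater than [M], whose sign is unknown;
   [|M| + 1] is one of them and is positive. *)
have {}fU y : U y -> `|f x - f y| <= (`|M| + 1) * `|x - y|.
  move=> Uy; apply: (fU (`|M| + 1) _ (x, y)).
    by rewrite (le_lt_trans (ler_norm M))// ltrDl.
  by split => //=; exact: nbhs_singleton Ux.
apply/(@cvgrPdist_lt _ _ _ (nbhs x)) => e e0; near=> y.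
rewrite (le_lt_trans (fU y _))//; first by near: y.
rewrite mulrC -ltr_pdivlMr ?ltr_wpDl//.
near: y; have : \forall y \near (x : 'rV[R]_n), `|x - y| < e / (`|M| + 1).
  apply/nbhs_normP; exists (e / (`|M| + 1)) => //=.
  by rewrite divr_gt0// ltr_wpDl.
exact.
Unshelve. all: by end_near. Qed.

Lemma continuous_borel_measurable (f : 'rV[R]_n -> R) :
  continuous f -> measurable_fun [set: borel_rV R n] f.
Proof.
move=> /continuousP cf; apply: (measurability _ (RGenOpens.measurableE R)).
move=> _ [_ [a [b ->] <-]]; rewrite setTI; apply: sub_gen_smallest.
exact/cf/interval_open.
Qed.

End locally_lipschitz.

(** This is convexity of [H \o sqrt] between [y ^+ 2] and 0 with weight [t ^+ 2]: the endpoint 0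
    contributes [H 0 = 0], and evenness removes the absolute values produced by the square roots. *)
Lemma sqrt_convex_scale (R : realType) (H : R -> R) (t y : R) :
  (forall x, H (- x) = H x) -> H 0 = 0 ->
  convex_function (`[0, +oo[%classic : set R^o) (fun x => H (Num.sqrt x)) ->
  0 <= t -> t <= 1 -> H (t * y) <= t ^+ 2 * H y.
Proof.
move=> Heven H0 Hc t0 t1.
have Hn z : H `|z| = H z.
  by have [_|_] := ger0P z; rewrite ?Heven.
have t2 : 0 <= t ^+ 2 <= 1 by rewrite exprn_ge0//= exprn_ile1.
pose p : {i01 R} := Itv01 (proj1 (andP t2)) (proj2 (andP t2)).
have := Hc p (y ^+ 2) 0.
rewrite !convRE /= !inE /= !in_itv/= !andbT lexx sqr_ge0 => /(_ isT isT).
have -> : conv p (y ^+ 2 : convex_lmodType R^o) 0 = t ^+ 2 * y ^+ 2.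
  change (t ^+ 2 * y ^+ 2 + (1 - t ^+ 2) * 0 = t ^+ 2 * y ^+ 2).
  by rewrite mulr0 addr0.
rewrite -exprMn !sqrtr_sqr sqrtr0 H0 mulr0 addr0.
by rewrite !Hn.
Qed.

(** * Passing from the truncations to the function *)

Section truncation.
Context d (T : measurableType d) (R : realType) (mu : probability T R).

Lemma measurable_clamp (N : R) : measurable_fun [set: R] (clamp N).
Proof.
by apply: measurable_maxr => //; exact: measurable_minr.
Qed.

Lemma cvg_clamp (r : R) : clamp k.+1%:R r @[k --> \oo] --> r.
Proof.
apply: cvg_near_cst; near=> k; apply: clamp_id.
rewrite (@le_trans _ _ k%:R)// ?ler_nat//.
by near: k; exact: nbhs_infty_ger.
Unshelve. all: by end_near. Qed.

(* As [+oo - +oo = -oo], a finite integral has finite positive and negative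
   parts. *)
Lemma integral_fin_num_integrable (u : T -> R) :
  measurable_fun setT u -> (\int[mu]_x (u x)%:E)%E \is a fin_num ->
  mu.-integrable setT (EFin \o u).
Proof.
move=> mu_ ufin.
have mEu : measurable_fun setT (EFin \o u) by exact/measurable_EFinP.
apply/integrableP; split => //.
move: ufin; rewrite integralE.
have : (0 <= \int[mu]_x ((EFin \o u)^\+ x))%E by exact: integral_ge0.
have : (0 <= \int[mu]_x ((EFin \o u)^\- x))%E by exact: integral_ge0.
rewrite (_ : (\int[mu]_x `|(EFin \o u) x|)%E =
  (\int[mu]_x ((EFin \o u)^\+ x) +
   \int[mu]_x ((EFin \o u)^\- x))%E); last first.
  rewrite -ge0_integralD//.
  - apply: eq_integral => x _.
    exact: (congr1 (@^~ x) (fune_abse (EFin \o u))).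
  - exact: measurable_funepos.
  - exact: measurable_funeneg.
(* Both parts have non-negative integrals with a finite difference, so only the case of two real
   values survives. *)
move: (\int[mu]_x _)%E (\int[mu]_x _)%E => [a||] [b||]//= _ _ _.
exact: ltry.
Qed.

(** The means of the truncations tend to the mean of [u], which is 0, by dominated convergence with
    bound [|u|]. Fatou's lemma then carries the exponential bounds to the limit, with no
    integrability of [expR u] assumed beforehand. *)
Lemma integral_expR_le_clamp (u : T -> R) (K : R) :
  measurable_fun setT u -> (\int[mu]_x (u x)%:E = 0)%E ->
  (forall k, ln (\int[mu]_x expR (clamp k.+1%:R (u x))) <=
     \int[mu]_x clamp k.+1%:R (u x) + K) ->
  (\int[mu]_x (expR (u x))%:E <= (expR K)%:E)%E.
Proof.
move=> mu_ u0 uK.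
have mEu : measurable_fun setT (EFin \o u) by exact/measurable_EFinP.
have intu : mu.-integrable setT (EFin \o u).
  by apply: integral_fin_num_integrable => //; rewrite u0.
have mc k : measurable_fun setT (fun x => clamp k.+1%:R (u x)).
  by apply: measurableT_comp => //; exact: measurable_clamp.
have cb k x : `|clamp k.+1%:R (u x)| <= k.+1%:R by exact: clamp_bound.
pose m k := \int[mu]_x clamp k.+1%:R (u x).
have m0 : (fun k => (m k)%:E) @ \oo --> 0%E.
  have [] := @dominated_convergence _ _ _ mu setT measurableT
    (fun k x => (clamp k.+1%:R (u x))%:E) (EFin \o u) (abse \o (EFin \o u)).
  - by move=> k; exact/measurable_EFinP.
  - exact: mEu.
  - apply: aeW => x _; apply: cvg_EFin; first exact: nearW.
    exact: cvg_clamp.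
  - exact: integrable_abse.
  - by apply: aeW => x k _ /=; rewrite lee_fin norm_clamp_le.
  move=> _ _; rewrite u0; apply: cvg_trans; apply: near_eq_cvg.
  apply: nearW => k; rewrite /m -Rintegral_EFin//.
  exact: integrable_bounded (cb k).
have expm : (fun k => (expR (m k + K))%:E) @ \oo --> (expR K)%:E.
  apply: cvg_EFin; first exact: nearW.
  apply: continuous_cvg; first exact: continuous_expR.
  rewrite -[X in _ --> X]add0r; apply: cvgD; last exact: cvg_cst.
  exact: (fine_cvg m0).
have -> : (\int[mu]_x (expR (u x))%:E)%E =
    (\int[mu]_x limn_einf (fun k => (expR (clamp k.+1%:R (u x)))%:E))%E.
  apply: eq_integral => x _; apply/esym.
  suff /cvg_limn_einf_sup[-> _] :
    (fun k => (expR (clamp k.+1%:R (u x)))%:E) @ \oo --> (expR (u x))%:E by [].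
  apply: cvg_EFin; first exact: nearW.
  apply: continuous_cvg; first exact: continuous_expR.
  exact: cvg_clamp.
apply: le_trans.
  apply: fatou => //.
  move=> k; apply/measurable_EFinP; exact: measurableT_comp.
(* [expR K] is rewritten as the lower limit of [expR (m k + K)], so that the two lower limits can be
   compared term by term. *)
have [<- _] := cvg_limn_einf_sup expm.
rewrite !limn_einf_lim; apply: lee_lim; [exact: is_cvg_einfs..|].
apply: nearW => k; apply: le_ereal_inf_tmp => _ [j /= kj <-].
apply: ge_ereal_inf; exists (\int[mu]_x (expR (clamp j.+1%:R (u x)))%:E)%E.
  by exists j.
rewrite Rintegral_EFin; last exact: integrable_expR_bounded (cb j).
rewrite lee_fin -[leLHS]lnK ?ler_expR ?uK// posrE.
exact: Rintegral_expR_gt0 (cb j).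
Qed.

End truncation.

(** * The exponential integrability bound *)

Theorem theorem3p7 (R : realType) (n : nat) (mu : probability (borel_rV R n) R)
    (H : R -> R)
    (H_ge0 : forall x, 0 <= H x)
    (H_even : forall x, H (- x) = H x)
    (H_convex : convex_function [set: R^o] H)
    (H_nondecreasing : {in `[0, +oo[ &, {homo H : x y / x <= y}})
    (H0 : H 0 = 0)
    (H_sqrt_convex :
      convex_function (`[0, +oo[%classic : set R^o) (fun x => H (Num.sqrt x)))
    (c : R) (c_gt0 : 0 < c)
    (mlsi : forall f : 'rV[R]_n -> R, locally_lipschitz f ->
      (Ent mu (fun x => expR (f x)) <=
        c%:E * \int[mu]_x
          ((\sum_(i < n) H (partial i f x / 2)) * expR (f x))%:E)%E) :
  forall f : 'rV[R]_n -> R, locally_lipschitz f ->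
    (\int[mu]_x (f x)%:E = 0)%E ->
  forall alpha : R, c < alpha ->
    (\int[mu]_x (expR (f x))%:E <=
      (\int[mu]_x (expR (alpha * \sum_(i < n) H (partial i f x / 2)))%:E)
        `^ (c / (alpha - c)))%E.
Proof.
move=> f fl f0 alpha calpha.
have a0 : 0 < alpha by exact: lt_trans calpha.
have ac0 : 0 < alpha - c by rewrite subr_gt0.
pose S (x : borel_rV R n) := \sum_(i < n) H (partial i f x / 2).
have S0 x : 0 <= S x by exact: sumr_ge0.
pose W (x : borel_rV R n) := alpha * S x.
have W0 x : 0 <= W x by rewrite mulr_ge0// ltW.
have cf : continuous f by exact: locally_lipschitz_continuous.
have mf : measurable_fun [set: borel_rV R n] f.
  exact: continuous_borel_measurable.
rewrite -/S -/W.
(* If the integral of [expR W] is infinite, so is the right-hand side, the exponent being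
   positive. *)
have [Woo|] := ltP (\int[mu]_x (expR (W x))%:E)%E +oo%E; last first.
  rewrite leye_eq => /eqP ->.
  by rewrite poweRyr ?leey// gt_eqF// divr_gt0.
have B1 := Rintegral_expR_ge1 (mu := mu) W0 Woo.
rewrite [in leRHS]ge0_Rintegral_EFin//.
(* Since its base is at least 1, the power unfolds to [expR K] with [K = c / (alpha - c) * ln B],
   where [B] is the integral of [expR W]. *)
rewrite poweR_EFin /powR gt_eqF ?(lt_le_trans _ B1)//.
apply: integral_expR_le_clamp => // k.
set N : R := k.+1%:R.
have mc : measurable_fun [set: borel_rV R n] (fun x => clamp N (f x)).
  by apply: measurableT_comp => //; exact: measurable_clamp.
apply: (herbst_bounded mc (fun x => clamp_bound (f x) _) W0 c_gt0) => //.
move=> t /andP[t0 t1].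
have tl : locally_lipschitz (fun x => t * clamp N (f x)).
  apply: (@locally_lipschitz_comp _ _ (fun r => t * clamp N r)) => // a b.
  rewrite -mulrBr normrM gtr0_norm//.
  by rewrite (le_trans _ (clamp_lipschitz N a b))// ler_piMl.
apply: (le_trans (mlsi _ tl)).
rewrite lee_pmul2l ?fin_numE//.
(* It remains to compare integrands pointwise, that is, [H (partial i (t * clamp N f) x / 2)] with
   [t ^+ 2 * H (partial i f x / 2)] for each [i]. *)
apply: ge0_le_lower_integral => x.
  by rewrite lee_fin mulr_ge0 ?expR_ge0// sumr_ge0.
rewrite lee_fin ler_wpM2r ?expR_ge0//.
rewrite /W mulrA divfK ?gt_eqF// mulr_sumr ler_sum// => i _.
(* Either the partial derivative is [t] times that of [f] and the scaling of [H] applies, or it is 0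
   and [H 0 = 0] gives the bound. *)
have [E|E] := derive_clamp (delta_mx 0 i) t0 (ler0n R k.+1) (cf x).
- rewrite /partial E -mulrA.
  by apply: sqrt_convex_scale => //; exact: ltW.
- by rewrite /partial E mul0r H0 mulr_ge0// sqr_ge0.
Qed.
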